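(* Let $v_i^1,v_i^2,v_i^3$ ($i\in[n]$) be XOS valuations on the item set $[m]$. For each $i$ independently let $(s_i,s'_i,r_i)$ be a uniformly random permutation of $(v_i^1,v_i^2,v_i^3)$. Let $\mathbf{p}^{(1)},\dots,\mathbf{p}^{(n+1)}$ be the prices of the modified (powers-of-two) buyer-wise greedy algorithm run on $\mathbf{s}=(s_1,\dots,s_n)$, and let $A'_i=d_i(s'_i,\mathbf{p}^{(i)})$ and $B_i=d_i(r_i,\mathbf{p}^{(i)})$ be the demand bundles of $s'_i$ and $r_i$ at prices $\mathbf{p}^{(i)}$. Then for every item $j\in[m]$, $$\mathbb{E}\Big[\max\Big(\max_{i:\,j\in B_i}a_j(r_i,B_i),\ \max_{i:\,j\in A'_i}a_j(s'_i,A'_i)\Big)\Big]\ \ge\ \frac1{32}\,\mathbb{E}\Big[\sum_{i:\,j\in B_i}a_j(r_i,B_i)+\sum_{i:\,j\in A'_i}a_j(s'_i,A'_i)\Big],$$ where a maximum over the empty set is $0$.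
   Context: Valuations are functions $v:2^{[m]}\to\mathbb{R}_{\ge0}$ with $v(\emptyset)=0$ that are monotone. $v$ is XOS if there is a finite collection of additive functions $a_\ell(B)=\sum_{j\in B}a_\ell(j)$ with $a_\ell(j)\ge0$ such that $v(B)=\max_\ell a_\ell(B)$ for all $B\subseteq[m]$. For an XOS valuation $v$ and $B\subseteq[m]$ fix an additive function from the collection attaining the maximum for $B$ (the additive supporting function of $v$ on $B$); $a_j(v,B)$ denotes its value on item $j$ if $j\in B$, and $0$ if $j\notin B$. Thus $\sum_{j\in B}a_j(v,B)=v(B)$ and $\sum_{j\in B'}a_j(v,B)\le v(B')$ for all $B'\subseteq[m]$. Demand: for each buyer $i$, valuation $v$ and prices $\mathbf{p}\in\mathbb{R}_{\ge0}^m$, $d_i(v,\mathbf{p})$ denotes a set $B\subseteq[m]$ maximizing $v(B)-\sum_{j\in B}p_j$, with ties broken in an arbitrary but consistent manner. Modified buyer-wise greedy algorithm on $\mathbf{s}$: let $\mathcal{P}=\{2^k: k\in\mathbb{Z}\}$ and $p_j^{(1)}=0$ for all $j$. For $i=1,\dots,n$: let $A_i=d_i(s_i,\mathbf{p}^{(i)})$; set $p_j^{(i+1)}=\min\{p\in\mathcal{P}: p\ge a_j(s_i,A_i)\}$ for $j\in A_i$ and $p_j^{(i+1)}=p_j^{(i)}$ for $j\notin A_i$.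
   Formalization: Ties in the demand are broken so that no buyer takes an item of positive price whose removal leaves her utility unchanged (with arbitrary ties the claim fails), and the new price is taken to be 0 when a_j(s_i,A_i)=0, where the minimum over powers of two does not exist. *)

(* Defs.v *)
From HB Require Import structures.
From mathcomp Require Import classical_sets reals.
From mathcomp Require Import all_boot all_order all_fingroup all_algebra.

Set Implicit Arguments.
Unset Strict Implicit.
Unset Printing Implicit Defensive.
Import Order.TTheory GRing.Theory Num.Theory.
Local Open Scope ring_scope.

Section XOS.
Variables (R : realType) (m : nat).

(* Finite functions, so that equality of valuations and of price vectors is
   extensional and a "consistent" choice is simply a function of them. *)
Definition setfun : Type := {ffun {set 'I_m} -> R}.
Definition itemfun : Type := {ffun 'I_m -> R}.

Definition is_valuation (v : setfun) : Prop :=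
  [/\ v set0 = 0, forall B, 0 <= v B & forall A B : {set 'I_m}, A \subset B -> v A <= v B].

Definition additive_val (w : itemfun) (B : {set 'I_m}) : R := \sum_(j in B) w j.

(* v(B) = max_{w in C} w(B) for all B, with all w in C nonnegative; the
   maximum is attained, so C is nonempty. *)
Definition xos_repr (v : setfun) (C : seq {ffun 'I_m -> R}) : Prop :=
  (forall w, w \in C -> forall j, 0 <= w j) /\
  forall B, (exists2 w, w \in C & v B = additive_val w B) /\
            (forall w, w \in C -> additive_val w B <= v B).

Definition is_xos (v : setfun) : Prop :=
  is_valuation v /\ exists C, xos_repr v C.

(* clauses v is the collection fixed for v, and supp v B the member of it
   fixed as the additive supporting function of v on B. *)
Definition is_supporting (clauses : setfun -> seq {ffun 'I_m -> R})
    (supp : setfun -> {set 'I_m} -> itemfun) : Prop :=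
  forall v, is_xos v ->
    xos_repr v (clauses v) /\
    forall B, supp v B \in clauses v /\ v B = additive_val (supp v B) B.

Definition support_val (supp : setfun -> {set 'I_m} -> itemfun)
    (v : setfun) (B : {set 'I_m}) (j : 'I_m) : R :=
  if j \in B then supp v B j else 0.

Definition utility (v : setfun) (p : itemfun) (B : {set 'I_m}) : R :=
  v B - \sum_(j in B) p j.

End XOS.

Section Greedy.
Variables (R : realType) (m n : nat).

Definition demand_fun : Type :=
  'I_n -> setfun R m -> itemfun R m -> {set 'I_m}.

Definition is_demand (d : demand_fun) : Prop :=
  forall i (v : setfun R m) (p : itemfun R m), is_valuation v -> (forall j, 0 <= p j) ->
  forall B, utility v p B <= utility v p (d i v p).

(* Tie-breaking convention: a buyer does not pay a positive price for an item
   she is indifferent about.  It only constrains ties, and ties on free items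
   remain arbitrary.  Without it, take one item, n >= 17 buyers, all of whose
   valuations give the item value 1: the price becomes 1 after the first buyer
   and, if ties are broken in favour of buying, stays there, so that every
   buyer contributes to the sum of the supporting values (2n in total) while
   their maximum is 1. *)
Definition no_indifferent_purchase (d : demand_fun) : Prop :=
  forall i (v : setfun R m) (p : itemfun R m), is_valuation v -> (forall j, 0 <= p j) ->
  forall j, j \in d i v p -> 0 < p j ->
    utility v p (d i v p :\ j) < utility v p (d i v p).

Definition powers2 : set R := [set x | exists k : int, x = 2 ^ k]%classic.

(* The least power of two that is at least a, for a > 0.  As an infimum it also
   gives a meaning to the case a = 0, where no least one exists: the value
   is then 0. *)
Definition round_up (a : R) : R :=
  inf [set x | powers2 x /\ a <= x]%classic.

Variables (d : demand_fun) (supp : setfun R m -> {set 'I_m} -> itemfun R m).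

Definition price_update (i : 'I_n) (v : setfun R m) (p : itemfun R m) :
    itemfun R m :=
  let A := d i v p in
  [ffun j => if j \in A then round_up (support_val supp v A j) else p j].

(* Buyers are numbered from 0: price s k is the price vector after buyers
   0, ..., k-1, so price s i is the one faced by buyer i. *)
Fixpoint price (s : 'I_n -> setfun R m) (k : nat) : itemfun R m :=
  if k is k'.+1 then
    if insub k' is Some i then price_update i (s i) (price s k')
    else price s k'
  else [ffun => 0].

End Greedy.

(* Expectation under the uniform distribution on T. *)
Definition uniform_expectation (R : realType) (T : finType) (X : T -> R) : R :=
  (\sum_(t : T) X t) / #|T|%:R.

Notation "''E_' ( w : T ) X" := (@uniform_expectation _ T (fun w => X))
  (at level 36, w name, T at level 200, X at level 36,
   format "''E_' ( w  :  T )  X") : ring_scope.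

(* Main.v *)
(* Write x_i^k for the supporting value of item j in the demand bundle of v_i^k
   at the prices p^(i), and let C_i be the maximum of the x_i'^k over all
   earlier buyers i' < i and all k.  Both x_i and C_i depend only on the
   permutations of the buyers before i, so exchanging the roles of s_i, s'_i
   and r_i preserves the expectation of any function of x_i and C_i.
   Along the greedy run each sale at least doubles a positive price, hence
   sum_i x(s_i) <= 4 max_(i, k) x_i^k, and by exchangeability the expected sum
   in the theorem is 2 E[sum_i x(s_i)].
   The maximum over all i, k is at most the total excess
   sum_(i, k) (x_i^k - C_i)^+, whose expectation is 3 E[sum_i (x(r_i) - C_i)^+];
   this last sum telescopes and is at most max_i x(r_i) on every path.
   Altogether the constant is 2 * 4 * 3 = 24 <= 32. *)
Require Import Defs.
From HB Require Import structures.
From mathcomp Require Import classical_sets reals.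
From mathcomp Require Import all_boot all_order all_fingroup all_algebra.
From mathcomp Require Import lra.

Set Implicit Arguments.
Unset Strict Implicit.
Unset Printing Implicit Defensive.
Import Order.TTheory GRing.Theory Num.Theory.
Local Open Scope ring_scope.

(** * Powers of two and rounding up *)

Lemma exists_le_exp2 (R : realType) (a : R) : exists n : nat, a <= 2 ^+ n.
Proof.
have [n an] : exists n : nat, a <= n%:R.
  by exists (Num.bound `|a|); apply: le_trans (ler_norm a) (ltW (archi_boundP (normr_ge0 a))).
by exists n; apply: le_trans an _; rewrite -natrX ler_nat ltnW // ltn_expl.
Qed.

Lemma exists_exp2_between (R : realType) (a : R) :
  0 < a -> exists k : int, 2 ^ (k - 1) < a <= 2 ^ k.
Proof.
move=> a0.
have [N aN] := exists_le_exp2 a.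
(* The [+ 1] makes [2 ^ (- M) < a] strict, so index 0 of the shifted search [P] fails and its least
   index is a successor. *)
have [M aM] := exists_le_exp2 (a^-1 + 1).
have aM' : 2 ^ (- M%:Z) < a.
  rewrite -invr_expz -[ltRHS]invrK ltf_pV2 ?posrE ?exprn_gt0 ?invr_gt0 //.
  by apply: lt_le_trans aM; rewrite ltrDl.
pose P n := a <= 2 ^ (n%:Z - M%:Z).
have exP : exists n, P n.
  by exists (N + M)%N; rewrite /P PoszD addrK.
case: (ex_minnP exP) => -[|n] Pn minn.
  by move: Pn; rewrite /P sub0r leNgt aM'.
exists (n.+1%:Z - M%:Z); rewrite [_ <= _]Pn andbT ltNge.
apply/negP => h; have /minn : P n.
  by rewrite /P (le_trans h) // intS addrAC (addrC 1) addrK.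
by rewrite ltnn.
Qed.

Lemma exp2_succ (R : realType) (k : int) : (2 : R) ^ (1 + k) = 2 * 2 ^ k.
Proof. by rewrite expfzDr ?pnatr_eq0 // expr1z. Qed.

Lemma exp2_lt_double (R : realType) (k l : int) :
  (2 : R) ^ k < 2 ^ l -> 2 * 2 ^ k <= (2 : R) ^ l.
Proof. by rewrite -exp2_succ ltr_eXz2l ?ler_eXz2l ?ltr1n // lez1D. Qed.

Lemma round_up_exp2 (R : realType) (a : R) (k : int) :
  2 ^ (k - 1) < a <= 2 ^ k -> round_up a = 2 ^ k.
Proof.
move=> /andP[ka ak].
have lbk : lbound [set x | powers2 x /\ a <= x]%classic (2 ^ k).
  move=> _ [[l ->] al]; have := exp2_lt_double (lt_le_trans ka al).
  by rewrite -exp2_succ addrC subrK.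
apply/eqP; rewrite eq_le; apply/andP; split.
  apply: ge_inf; first by exists (2 ^ k).
  by split => //; exists k.
by apply: lb_le_inf => //; exists (2 ^ k); split => //; exists k.
Qed.

Lemma round_up0 (R : realType) : round_up (0 : R) = 0.
Proof.
have lb0 : lbound [set x | powers2 x /\ 0 <= x]%classic (0 : R) by move=> x [].
have ne : ([set x : R | powers2 x /\ 0 <= x] !=set0)%classic.
  by exists (2 ^ 0); split; [exists 0 | exact: ler01].
(* A positive infimum would exceed some power of two, which itself lies in the set. *)
apply/eqP; rewrite eq_le lb_le_inf // andbT leNgt; apply/negP => e0.
have [k /andP[ke _]] := exists_exp2_between e0.
move: ke; apply/negP; rewrite -leNgt; apply: ge_inf; first by exists 0.
by split; [exists (k - 1) | exact/ltW/exprz_gt0].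
Qed.

Lemma round_up_bounds (R : realType) (a : R) :
  0 <= a -> a <= round_up a <= 2 * a.
Proof.
rewrite le_eqVlt => /predU1P[<-|a0]; first by rewrite round_up0 mulr0 lexx.
have [k kP] := exists_exp2_between a0; rewrite (round_up_exp2 kP).
case/andP: kP => ka ->; rewrite -[k in leLHS](subrK 1) [k - 1 + 1]addrC exp2_succ.
by rewrite ler_pM2l ?ltW.
Qed.

(** The invariant of the prices: 0 occurs as the initial price and as the rounding of a zero
    supporting value. *)
Definition zero_or_exp2 (R : realType) (x : R) := x = 0 \/ powers2 x.

Lemma zero_or_exp2_ge0 (R : realType) (x : R) : zero_or_exp2 x -> 0 <= x.
Proof. by case=> [->|[k ->]] //; exact/ltW/exprz_gt0. Qed.

Lemma zero_or_exp2_round_up (R : realType) (a : R) :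
  0 <= a -> zero_or_exp2 (round_up a).
Proof.
rewrite le_eqVlt => /predU1P[<-|a0]; first by left; exact: round_up0.
have [k kP] := exists_exp2_between a0.
by right; exists k; exact: round_up_exp2.
Qed.

(** For [0 < p], both sides are powers of two with [p < a <= round_up a], and distinct powers of two
    differ by a factor of at least 2. *)
Lemma round_up_double (R : realType) (p a : R) :
  zero_or_exp2 p -> 0 <= a -> (0 < p -> p < a) -> 2 * p <= round_up a.
Proof.
move=> pP a0 pa; have /andP[le_a _] := round_up_bounds a0.
case: pP pa => [-> _|[k ->]]; first by rewrite mulr0 (le_trans a0).
rewrite exprz_gt0 // => /(_ isT) ka.
have [l lP] := exists_exp2_between (lt_trans (exprz_gt0 k (ltr0n R 2)) ka).
move: le_a; rewrite (round_up_exp2 lP) => al.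
exact: exp2_lt_double (lt_le_trans ka al).
Qed.

(** * Supporting values and prices along the greedy run *)

Lemma support_val_ge0 (R : realType) (m : nat)
    (clauses : setfun R m -> seq {ffun 'I_m -> R})
    (supp : setfun R m -> {set 'I_m} -> itemfun R m) :
  is_supporting clauses supp ->
  forall v, is_xos v -> forall A j, 0 <= support_val supp v A j.
Proof.
move=> hsupp v /hsupp[[pos _] /= sup] A j; rewrite /support_val.
by case: ifP => // _; apply: pos; case: (sup A).
Qed.

(** The clause supporting the demand bundle still bounds [v] from below once [j] is removed, so the
    removal costs at most the supporting value of [j]; by the tie-breaking rule it costs more than
    [p j]. *)
Lemma lt_support_val (R : realType) (m n : nat)
    (clauses : setfun R m -> seq {ffun 'I_m -> R})
    (supp : setfun R m -> {set 'I_m} -> itemfun R m) (d : demand_fun R m n) :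
  is_supporting clauses supp -> no_indifferent_purchase d ->
  forall i v (p : itemfun R m) j, is_xos v -> (forall k, 0 <= p k) ->
  j \in d i v p -> 0 < p j -> p j < support_val supp v (d i v p) j.
Proof.
move=> hsupp hties i v p j hv p0 jA pj.
have := hties i v p hv.1 p0 j jA pj.
have [[_ repr] sup] := hsupp v hv; rewrite /support_val jA /utility.
move: (d i v p) jA => A jA; have [wC vA] := sup A.
have := (repr (A :\ j)).2 _ wC; rewrite vA /additive_val.
rewrite (big_setD1 _ jA) [in X in _ < _ - X](big_setD1 _ jA) /=.
lra.
Qed.

Lemma price_local (R : realType) (m n : nat) (d : demand_fun R m n)
    (supp : setfun R m -> {set 'I_m} -> itemfun R m)
    (s t : 'I_n -> setfun R m) (k : nat) :
  (forall i : 'I_n, (i < k)%N -> s i = t i) ->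
  price d supp s k = price d supp t k.
Proof.
elim: k => //= k IH st; rewrite IH => [|i ik]; last by rewrite st // ltnW.
by case: insubP => // i _ ik; rewrite st // ik.
Qed.

Lemma price_zero_or_exp2 (R : realType) (m n : nat)
    (clauses : setfun R m -> seq {ffun 'I_m -> R})
    (supp : setfun R m -> {set 'I_m} -> itemfun R m) (d : demand_fun R m n)
    (s : 'I_n -> setfun R m) :
  is_supporting clauses supp -> (forall i, is_xos (s i)) ->
  forall k j, zero_or_exp2 (price d supp s k j).
Proof.
move=> hsupp hs; elim=> [|k IH] j /=; first by left; rewrite ffunE.
case: insubP => // i _ _; rewrite ffunE; case: ifP => // _.
exact/zero_or_exp2_round_up/(support_val_ge0 hsupp).
Qed.

(** Twice the price serves as a potential. A sale at old price [p] with value [y] sets a price [q]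
    with [q >= 2 * p] and [q >= y], so [2 * q] absorbs both the old potential and [y]; and
    [q <= 2 * y <= 2 * M]. *)
Lemma price_bounds (R : realType) (m n : nat)
    (clauses : setfun R m -> seq {ffun 'I_m -> R})
    (supp : setfun R m -> {set 'I_m} -> itemfun R m) (d : demand_fun R m n)
    (s : 'I_n -> setfun R m) (j : 'I_m)
    (x := fun i => support_val supp (s i) (d i (s i) (price d supp s i)) j)
    (M : R) :
  is_supporting clauses supp -> no_indifferent_purchase d ->
  (forall i, is_xos (s i)) -> 0 <= M -> (forall i, x i <= M) ->
  forall k, \sum_(i < n | (i < k)%N) x i <= 2 * price d supp s k j <= 4 * M.
Proof.
move=> hsupp hties hs M0 xM; elim=> [|k /andP[sumP PM]] /=.
  by rewrite ffunE mulr0 big_pred0 // lexx mulr_ge0.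
case: insubP => [i _ ik|nk]; last first.
  rewrite PM andbT (le_trans _ sumP) // le_eqVlt; apply/orP; left; apply/eqP.
  by apply: eq_bigl => i; rewrite ltnS leq_eqVlt; case: eqP => // ik; case/negP: nk; rewrite -ik.
have sumE : \sum_(i' < n | (i' < k.+1)%N) x i' = x i + \sum_(i' < n | (i' < k)%N) x i'.
  rewrite (bigD1 i) ?ik //=; congr (_ + _); apply: eq_bigl => i'.
  by rewrite -val_eqE /= ik ltnS ltn_neqAle andbC.
rewrite sumE ffunE.
have p2 := price_zero_or_exp2 d hsupp hs k.
have p0 j' : 0 <= price d supp s k j' by exact: zero_or_exp2_ge0.
have := xM i; rewrite /x ik; case: ifP => jA xiM; last by rewrite /support_val jA add0r sumP.
have x0 := support_val_ge0 hsupp (hs i) (d i (s i) (price d supp s k)) j.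
have := round_up_double (p2 j) x0 (lt_support_val hsupp hties (hs i) p0 jA).
have := round_up_bounds x0.
move: sumP; set S := \sum_(_ < _ | _) _; set q := round_up _; set y := support_val _ _ _ _ in xiM *.
by move=> sP /andP[yq q2] pq; apply/andP; split; lra.
Qed.

(** * Sums of excesses over a running maximum *)

Lemma sum_excess_le (R : realDomainType) (n : nat) (x C : 'I_n -> R) (M : R) :
  (forall i, 0 <= C i) -> (forall i k : 'I_n, (i < k)%N -> x i <= C k) ->
  0 <= M -> (forall i, x i <= M) ->
  \sum_i Num.max 0 (x i - C i) <= M.
Proof.
elim: n x C M => [|n IH] x C M C0 xC M0 xM; first by rewrite big_ord0.
rewrite big_ord_recr /=.
have IHm (N : R) : 0 <= N -> (forall i : 'I_n, x (widen_ord (leqnSn n) i) <= N) ->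
    \sum_(i < n) Num.max 0 (x (widen_ord (leqnSn n) i) - C (widen_ord (leqnSn n) i)) <= N.
  by move=> N0 xN; apply: IH => // i k ik; apply: xC.
case: (leP (x ord_max - C ord_max) 0) => [_|_].
  by rewrite addr0 IHm.
(* When the last excess is positive, the earlier ones sum to at most [C ord_max], so the total is at
   most [x ord_max]. *)
have := IHm (C ord_max) (C0 _) (fun i => xC (widen_ord (leqnSn n) i) ord_max (ltn_ord i)).
by have := xM ord_max; lra.
Qed.

Lemma le_sum_excess (R : realDomainType) (n : nat) (y e : 'I_n -> R) :
  (forall i, 0 <= e i) ->
  (forall i, y i <= e i + \big[Num.max/0]_(k < n | (k < i)%N) y k) ->
  forall i, y i <= \sum_k e k.
Proof.
move=> e0 ye i.
(* Strong induction needs the sharper bound by the partial sum up to [i]: the maximum over [k < i]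
   then leaves room for [e i]. *)
apply: (@le_trans _ _ (\sum_(k < n | (k <= i)%N) e k)); last first.
  by rewrite [leRHS](bigID (fun k : 'I_n => (k <= i)%N)) lerDl sumr_ge0.
have [N] := ubnP (i : nat); elim: N i => // N IH i iN.
apply: le_trans (ye i) _; rewrite [leRHS](bigD1 i) //= lerD2l.
apply: bigmax_le => [|k ki]; first exact: sumr_ge0.
apply: le_trans (IH k (leq_trans ki iN)) _.
rewrite big_mkcond [leRHS]big_mkcond; apply: ler_sum => l _ /=.
case: (leqP l k) => [lk|_]; last by case: ifP.
have li := leq_ltn_trans lk ki.
by rewrite (ltnW li) -val_eqE neq_ltn li.
Qed.

(** * Exchangeability and the main estimate *)

(** Composing [w i] with the transposition of [a] and [b] is an involution of the sample space that
    keeps the earlier coordinates, hence [F], and turns [w i a] into [w i b]. *)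
Lemma sum_swap (R : nmodType) (n q : nat) (i : 'I_n) (a b : 'I_q)
    (F : {ffun 'I_n -> 'S_q} -> 'I_q -> R) :
  (forall w w' : {ffun 'I_n -> 'S_q}, (forall k : 'I_n, (k < i)%N -> w k = w' k) -> F w =1 F w') ->
  \sum_w F w (w i a) = \sum_w F w (w i b).
Proof.
move=> Floc.
pose h (w : {ffun 'I_n -> 'S_q}) : {ffun 'I_n -> 'S_q} :=
  [ffun k => if k == i then (tperm a b * w i)%g else w k].
have hK : involutive h.
  move=> w; apply/ffunP => k; rewrite !ffunE eqxx; case: eqP => [->|//].
  by rewrite mulgA tperm2 mul1g.
rewrite (reindex_inj (inv_inj hK)); apply: eq_bigr => w _.
rewrite ffunE eqxx permM tpermL; apply: Floc => k ki.
by rewrite ffunE -val_eqE (ltn_eqF ki).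
Qed.

(* The sample space {ffun 'I_n -> 'S_3} with the uniform distribution is an
   independent uniform permutation of the three valuations for each buyer. *)
Theorem lemma3p7 (R : realType) (m n : nat)
    (clauses : setfun R m -> seq {ffun 'I_m -> R})
    (supp : setfun R m -> {set 'I_m} -> itemfun R m)
    (hsupp : is_supporting clauses supp)
    (d : demand_fun R m n)
    (hd : is_demand d)
    (hties : no_indifferent_purchase d)
    (v : 'I_n -> 'I_3 -> setfun R m)
    (hv : forall i k, is_xos (v i k))
    (j : 'I_m) :
  let s (w : {ffun 'I_n -> 'S_3}) i := v i (w i 0) in
  let s' (w : {ffun 'I_n -> 'S_3}) i := v i (w i 1) in
  let r (w : {ffun 'I_n -> 'S_3}) i := v i (w i 2) in
  let p (w : {ffun 'I_n -> 'S_3}) (i : 'I_n) := price d supp (s w) i in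
  let A' w i := d i (s' w i) (p w i) in
  let B w i := d i (r w i) (p w i) in
  'E_(w : {ffun 'I_n -> 'S_3})
    (Num.max
      (\big[Num.max/0]_(i < n | j \in B w i) support_val supp (r w i) (B w i) j)
      (\big[Num.max/0]_(i < n | j \in A' w i)
         support_val supp (s' w i) (A' w i) j))
  >= 1 / 32 *
  'E_(w : {ffun 'I_n -> 'S_3})
    (\sum_(i < n | j \in B w i) support_val supp (r w i) (B w i) j
     + \sum_(i < n | j \in A' w i) support_val supp (s' w i) (A' w i) j).
Proof.
cbv zeta.
pose s (w : {ffun 'I_n -> 'S_3}) i := v i (w i 0).
pose s' (w : {ffun 'I_n -> 'S_3}) i := v i (w i 1).
pose r (w : {ffun 'I_n -> 'S_3}) i := v i (w i 2).
pose p (w : {ffun 'I_n -> 'S_3}) (i : 'I_n) := price d supp (s w) i.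
pose A' w i := d i (s' w i) (p w i).
pose B w i := d i (r w i) (p w i).
(* The index [k] is the label of the valuation, not its role; thus [X w i] does not depend on [w i],
   and roles enter only through [w i 0], [w i 1], [w i 2]. *)
pose X (w : {ffun 'I_n -> 'S_3}) i k :=
  support_val supp (v i k) (d i (v i k) (p w i)) j.
pose C (w : {ffun 'I_n -> 'S_3}) (i : 'I_n) :=
  \big[Num.max/0]_(k < n | (k < i)%N) \big[Num.max/0]_l X w k l.
pose e w i k := Num.max 0 (X w i k - C w i).
have X0 w i k : 0 <= X w i k by exact: (support_val_ge0 hsupp).
have e0 w i k : 0 <= e w i k by rewrite le_max lexx.
have Xloc (i : 'I_n) (w w' : {ffun 'I_n -> 'S_3}) :
    (forall k : 'I_n, (k < i)%N -> w k = w' k) -> X w i =1 X w' i.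
  move=> ww' k; rewrite /X; congr (support_val _ _ (d _ _ _) _).
  by apply: price_local => i' i'i; rewrite /s ww'.
have eloc (i : 'I_n) (w w' : {ffun 'I_n -> 'S_3}) :
    (forall k : 'I_n, (k < i)%N -> w k = w' k) -> e w i =1 e w' i.
  move=> ww' k; rewrite /e (Xloc i w w') //; congr (Num.max 0 (_ - _)).
  apply: eq_bigr => i' i'i; apply: eq_bigr => l _; apply: Xloc => k' k'i'.
  by apply: ww'; exact: ltn_trans i'i.
have restrict (F : 'I_n -> 'I_3) w :
    \sum_(i < n | j \in d i (v i (F i)) (p w i)) X w i (F i) =
    \sum_i X w i (F i).
  rewrite big_mkcond; apply: eq_bigr => i _.
  by rewrite /X /support_val; case: (j \in _).
pose Max w := Num.max
  (\big[Num.max/0]_(i < n | j \in B w i) support_val supp (r w i) (B w i) j)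
  (\big[Num.max/0]_(i < n | j \in A' w i) support_val supp (s' w i) (A' w i) j).
pose Sum w :=
  \sum_(i < n | j \in B w i) support_val supp (r w i) (B w i) j
  + \sum_(i < n | j \in A' w i) support_val supp (s' w i) (A' w i) j.
change (1 / 32 * 'E_(w : {ffun 'I_n -> 'S_3}) (Sum w) <=
  'E_(w : {ffun 'I_n -> 'S_3}) (Max w)).
rewrite /uniform_expectation.
have SumE w : Sum w = \sum_i X w i (w i 2) + \sum_i X w i (w i 1).
  exact: (congr2 _ (restrict (fun i => w i 2) w) (restrict (fun i => w i 1) w)).
have Max0 w : 0 <= Max w by rewrite le_max bigmax_ge_id.
have XMax w i : X w i (w i 2) <= Max w.
  case jB: (j \in B w i); last by rewrite /X /support_val [_ \in _]jB.
  by rewrite le_max; apply/orP; left; apply: (bigmax_sup i).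
have eMax w : \sum_i e w i (w i 2) <= Max w.
  apply: sum_excess_le => // [i|i k ik]; first exact: bigmax_ge_id.
  by apply: (bigmax_sup i) => //; exact: le_bigmax.
(* With [y i] the maximum over the labels, the running maximum of the earlier [y] is exactly
   [C w i]. *)
have X_le_e w i k : X w i k <= \sum_i \sum_l e w i l.
  apply: le_trans (le_bigmax 0 (X w i) k) _.
  apply: (le_sum_excess (y := fun i => \big[Num.max/0]_l X w i l)) => i'.
    exact: sumr_ge0.
  rewrite -/(C w i'); apply: bigmax_le => [|l _].
    by rewrite addr_ge0 ?sumr_ge0 ?bigmax_ge_id.
  rewrite -lerBlDr (bigD1 l) //=; apply: (@le_trans _ _ (e w i' l)).
    by rewrite le_max lexx orbT.
  by rewrite lerDl sumr_ge0.
have sX w : \sum_i X w i (w i 0) <= 4 * \sum_i \sum_l e w i l.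
  have := @price_bounds R m n clauses supp d (s w) j (\sum_i \sum_l e w i l)
    hsupp hties (fun i => hv _ _).
  (* At time [n] the restriction to earlier buyers is vacuous; [M] is the total excess. *)
  case/(_ _ _ n)/andP => [|i|sP P4].
  - by apply: sumr_ge0 => i _; exact: sumr_ge0.
  - exact: X_le_e.
  apply: le_trans P4; apply: le_trans sP.
  by rewrite [leRHS](eq_bigl xpredT) // => i; exact: ltn_ord.
have swapX a b : \sum_w \sum_i X w i (w i a) = \sum_w \sum_i X w i (w i b).
  rewrite exchange_big [RHS]exchange_big; apply: eq_bigr => i _ /=.
  by apply: (@sum_swap _ _ _ i a b (fun w => X w i)) => w w'; exact: Xloc.
have swape a b : \sum_w \sum_i e w i (w i a) = \sum_w \sum_i e w i (w i b).
  rewrite exchange_big [RHS]exchange_big; apply: eq_bigr => i _ /=.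
  by apply: (@sum_swap _ _ _ i a b (fun w => e w i)) => w w'; exact: eloc.
have sumSum : \sum_w Sum w = 2 * \sum_w \sum_i X w i (w i 0).
  under eq_bigr do rewrite SumE.
  by rewrite big_split /= (swapX 2 0) (swapX 1 0) mulr_natl mulr2n.
have sume : \sum_w \sum_i \sum_l e w i l = 3 * \sum_w \sum_i e w i (w i 2).
  have -> : \sum_w \sum_i \sum_l e w i l = \sum_(a < 3) \sum_w \sum_i e w i (w i a).
    rewrite [RHS]exchange_big; apply: eq_bigr => w _ /=.
    rewrite [RHS]exchange_big; apply: eq_bigr => i _ /=.
    (* For fixed [w] and [i], summing over labels equals summing over roles, as [w i] is a
       bijection. *)
    by rewrite (reindex_inj (@perm_inj _ (w i))).
  under eq_bigr => a _ do rewrite (swape a 2).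
  by rewrite sumr_const card_ord mulr_natl.
have le1 : \sum_w \sum_i X w i (w i 0) <= 4 * \sum_w \sum_i \sum_l e w i l.
  by rewrite mulr_sumr ler_sum.
have le2 : \sum_w \sum_i e w i (w i 2) <= \sum_w Max w by exact: ler_sum.
(* Nonnegativity is what allows the constant 24 to be relaxed to 32. *)
have le3 : 0 <= \sum_w Max w by exact: sumr_ge0.
rewrite mulrA ler_pM2r ?invr_gt0 ?ltr0n; last first.
  by apply/card_gt0P; exists [ffun=> 1%g].
lra.
Qed.
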